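(* Let $(G,R)$ be a finite rooted graph without sinks such that $t^{-1}(R)=\emptyset$, $|o^{-1}(R)|>2$, and the graph $G\setminus\{R\}$ is strongly connected and non-redundant. If the unfolding tree $\mathcal{T}(G,R)$ is cocompact, then $(G,R)$ admits an actual labelling.
   Context: A graph $G=(VG,EG,o,t)$ is a directed multigraph (loops and multiple edges allowed). A sink is a vertex $v$ with $o^{-1}(v)=\emptyset$. A path is an empty path $\varepsilon_v$ or a sequence $e_1\cdots e_n$ of edges with $t(e_i)=o(e_{i+1})$; $O(p),T(p)$ are its origin and terminus. A rooted graph $(G,R)$ is a graph with a vertex $R$ from which every vertex is reachable. $G\setminus\{R\}$ is the subgraph obtained by deleting $R$ and all edges incident to it; it is strongly connected if any vertex can be reached from any other by a directed path. A rooted tree is a graph with a vertex $R$ such that every vertex has a unique path from $R$. The unfolding tree $\mathcal{T}(G,R)$ has vertices the paths $p$ with $O(p)=R$ and edges $(p,pe)$ from $p$ to $pe$ for each edge $e$ with $o(e)=T(p)$. For a rooted tree $\mathcal{T}$ with root $R$ and vertex $v$, $\mathcal{T}^v$ is obtained by reversing the edges on the path from $R$ to $v$. $\cong$ is isomorphism of directed graphs. A rooted tree is cocompact if there are a finite set $F$ and $l:V\mathcal{T}\to F$ with $l(v)=l(w)\Rightarrow\mathcal{T}^v\cong\mathcal{T}^w$. Non-edge-collapsing (n.e.c.) relation on a graph $H$: an equivalence relation $\sim$ on vertices and on edges, compatible with $o$ and $t$, such that for all vertices $v\sim w$ there are bijections $\pi_{v,w}:o^{-1}(v)\to o^{-1}(w)$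 with $e\sim f\iff o(e)\sim o(f)$ and $\pi_{o(e),o(f)}(e)=f$. A graph $H$ is non-redundant if the only n.e.c. relation on $H$ is equality. Multisets over $X$ have positive integer multiplicities; union adds multiplicities; $M\setminus\{x\}$ removes one copy. $t_m(o^{-1}(v))$ is the multiset of termini of edges leaving $v$ counted with the number of edges; $l(t_m(o^{-1}(v)))$ its multiset of labels. Actual labelling of $(G,R)$ with $t^{-1}(R)=\emptyset$: a finite set $X$, maps $l:VG\to X$, $l_p:VG\setminus\{R\}\to X$, and multisets $M_x$ ($x\in X$) such that for all $v\neq R$: (1) $l_p(v)\in M_{l(v)}$; (2) $l(t_m(o^{-1}(v)))=M_{l(v)}\setminus\{l_p(v)\}$; (3) $l(o(e))=l_p(v)$ for all edges $e$ with $t(e)=v$; and (4) $l(t_m(o^{-1}(R)))=M_{l(R)}$. *)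

(* Defs.v *)
From mathcomp Require Import all_boot.
From mathcomp Require Import boolp classical_sets functions.
From mathcomp Require Import finmap multiset.

Set Implicit Arguments.
Unset Strict Implicit.
Unset Printing Implicit Defensive.

Local Open Scope mset_scope.

Record digraph := Digraph {
  vertex : eqType;
  edge : eqType;
  org : edge -> vertex;
  ter : edge -> vertex
}.

(* A path is stored as its origin together with its list of edges, so that the
   empty path at x is (x, [::]). *)
Fixpoint walk (G : digraph) (x : vertex G) (p : seq (edge G)) : bool :=
  if p is e :: p' then (org e == x) && walk (ter e) p' else true.

Definition terminus (G : digraph) (x : vertex G) (p : seq (edge G)) : vertex G :=
  last x (map (@ter G) p).

Definition reachable (G : digraph) (x y : vertex G) : Prop :=
  exists p, walk x p /\ terminus x p = y.

Definition rooted (G : digraph) (R : vertex G) : Prop :=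
  forall v, reachable R v.

Definition no_sinks (G : digraph) : Prop :=
  forall v : vertex G, exists e : edge G, org e = v.

Definition strongly_connected (G : digraph) : Prop :=
  forall x y : vertex G, reachable x y.

Definition rooted_tree (T : digraph) (R : vertex T) : Prop :=
  forall v, exists! p, walk R p /\ terminus R p = v.

Definition isomorphic (G H : digraph) : Prop :=
  exists (fV : vertex G -> vertex H) (fE : edge G -> edge H),
    [/\ bijective fV, bijective fE,
        (forall e, org (fE e) = fV (org e)) &
        (forall e, ter (fE e) = fV (ter e))].

Section Deletion.
Variables (G : digraph) (R : vertex G).

Definition del_vertex : eqType := {v : vertex G | v != R}.
Definition del_edge : eqType := {e : edge G | (org e != R) && (ter e != R)}.

Definition del_org (e : del_edge) : del_vertex :=
  exist _ (org (val e)) (proj1 (andP (valP e))).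
Definition del_ter (e : del_edge) : del_vertex :=
  exist _ (ter (val e)) (proj2 (andP (valP e))).

Definition delete : digraph := Digraph del_org del_ter.

End Deletion.

(* The family pi is given by total functions on edges; only the restriction of
   pi v w to the edges leaving v, for related v and w, is ever constrained. *)
Definition nec_relation (H : digraph) (rV : rel (vertex H)) (rE : rel (edge H)) :
    Prop :=
  [/\ equivalence_rel rV,
      equivalence_rel rE,
      (forall e f, rE e f -> rV (org e) (org f) /\ rV (ter e) (ter f)) &
      exists pi : vertex H -> vertex H -> edge H -> edge H,
        (forall v w, rV v w ->
           set_bij [set e | org e = v]%classic [set f | org f = w]%classic
             (pi v w)) /\
        (forall e f, rE e f <->
           rV (org e) (org f) /\ pi (org e) (org f) e = f)].

Definition non_redundant (H : digraph) : Prop :=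
  forall (rV : rel (vertex H)) (rE : rel (edge H)), nec_relation rV rE ->
    (forall v w, rV v w <-> v = w) /\ (forall e f, rE e f <-> e = f).

(* T^v, for T a tree with root R. *)
Section Reroot.
Variables (T : digraph) (R v : vertex T).

Definition on_root_path (e : edge T) : Prop :=
  exists p, [/\ walk R p, terminus R p = v & e \in p].

Definition reroot : digraph :=
  @Digraph (vertex T) (edge T)
    (fun e => if `[< on_root_path e >] then ter e else org e)
    (fun e => if `[< on_root_path e >] then org e else ter e).

End Reroot.

Definition cocompact (T : digraph) (R : vertex T) : Prop :=
  exists (F : finType) (l : vertex T -> F),
    forall v w, l v = l w -> isomorphic (reroot R v) (reroot R w).

Section Unfolding.
Variables (G : digraph) (R : vertex G).

Lemma walk_rcons (x : vertex G) p e :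
  walk x (rcons p e) = walk x p && (org e == terminus x p).
Proof.
elim: p x => [|f p IHp] x /=; first by rewrite andbT.
by rewrite IHp andbA.
Qed.

Definition unfold_vertex : eqType := {p : seq (edge G) | walk R p}.

(* The edge (p, pe) of the unfolding tree is represented by the pair (p, e). *)
Definition unfold_edge : eqType :=
  {x : unfold_vertex * edge G | org x.2 == terminus R (val x.1)}.

Lemma unfold_ter_proof (x : unfold_edge) :
  walk R (rcons (val (val x).1) (val x).2).
Proof. by rewrite walk_rcons (valP (val x).1) (valP x). Qed.

Definition unfold_org (x : unfold_edge) : unfold_vertex := (val x).1.
Definition unfold_ter (x : unfold_edge) : unfold_vertex :=
  exist _ (rcons (val (val x).1) (val x).2) (unfold_ter_proof x).

Definition unfolding : digraph := Digraph unfold_org unfold_ter.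

Definition unfold_root : vertex unfolding := exist _ [::] isT.

End Unfolding.

Lemma terminus_rcons (G : digraph) (x : vertex G) p e :
  terminus x (rcons p e) = ter e.
Proof. by rewrite /terminus map_rcons last_rcons. Qed.

Lemma unfolding_rooted_tree (G : digraph) (R : vertex G) :
  rooted_tree (unfold_root R).
Proof.
have key q (wq : walk (unfold_root R) q) :
    val (terminus (unfold_root R) q) = [seq (val x).2 | x <- q].
  elim/last_ind: q wq => [//|q x IHq]; rewrite walk_rcons => /andP[wq /eqP xq].
  by rewrite terminus_rcons map_rcons -IHq // -xq.
case=> p; elim/last_ind: p => [|p e IHp] wp.
  exists [::]; split; first by split=> //; apply: val_inj.
  move=> q [wq /(congr1 val)/=]; rewrite key //.
  by case: q {wq}.
have := wp; rewrite walk_rcons => /andP[wp' ep].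
have [q [[wq tq] uq]] := IHp wp'.
pose x : edge (unfolding R) := exist _ (exist _ p wp', e) ep.
have xq : org x = terminus (unfold_root R) q by rewrite tq.
exists (rcons q x); split.
  split; first by rewrite walk_rcons wq; apply/eqP.
  by rewrite terminus_rcons; apply: val_inj.
move=> q'; case/lastP: q' => [[_ /(congr1 val)/=]|q' y].
  by case: (p).
rewrite walk_rcons terminus_rcons => -[/andP[wq' /eqP yq'] /(congr1 val)/=].
move/rcons_inj=> [yp ye].
have yo : org y = exist _ p wp' by apply: val_inj.
rewrite (uq q'); last by rewrite -yq' yo.
congr rcons; apply: val_inj.
by apply: injective_projections => /=; [rewrite -yo|rewrite ye].
Qed.

Section ActualLabelling.
Variables (V E : finType) (o t : E -> V) (R : V).

Definition label_termini (X : choiceType) (l : V -> X) (v : V) : {mset X} :=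
  seq_mset [seq l (t e) | e <- enum [pred e | o e == v]].

Definition is_actual_labelling (X : finType) (l : V -> X)
    (lp : {v : V | v != R} -> X) (M : X -> {mset X}) : Prop :=
  (forall v : {v : V | v != R},
     [/\ lp v \in M (l (val v)),
         label_termini l (val v) = M (l (val v)) `\ lp v &
         forall e, t e = val v -> l (o e) = lp v]) /\
  label_termini l R = M (l R).

Definition has_actual_labelling : Prop :=
  exists (X : finType) (l : V -> X) (lp : {v : V | v != R} -> X)
         (M : X -> {mset X}),
    is_actual_labelling l lp M.

End ActualLabelling.

(* Main.v *)
Require Import Defs.
From mathcomp Require Import all_boot.
From mathcomp Require Import boolp classical_sets functions.
From mathcomp Require Import finmap multiset.

(* Call the cone of a vertex v of G the branch of the unfolding below any path
   ending at v.  By non-redundancy, distinct vertices other than R have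
   non-isomorphic cones, and already non-isomorphic truncations at some fixed
   depth.  By cocompactness and the absence of sinks, below any path p there is
   an image q of the root under an automorphism of the undirected unfolding.
   Around q, all branches are copies of cones, and so is the branch seen when
   looking back from any non-root vertex on the path to q.  Hence looking back
   from p one sees the cone of some vertex b(p) of G.  If p and p' end at the
   same vertex, then after extending both by the same path of length n the
   branches seen looking back agree up to depth n, hence are equal for n large,
   and going back up the path b(p) = b(p').  So b is a function on the vertices
   of G, and v can be labelled by the multiset of the branches around it, i.e.
   the successors of v together with b(v). *)

Set Implicit Arguments.
Unset Strict Implicit.
Unset Printing Implicit Defensive.

(** * Paths in a graph *)

Section Walks.
Variable G : digraph.

Lemma terminus_cat (x : vertex G) p p' :
  terminus x (p ++ p') = terminus (terminus x p) p'.
Proof. by rewrite /terminus map_cat last_cat. Qed.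

Lemma walk_cat (x : vertex G) p p' :
  walk x (p ++ p') = walk x p && walk (terminus x p) p'.
Proof. by elim: p x => //= e p IHp x; rewrite IHp andbA. Qed.

Lemma walk_prefix (x : vertex G) p q : prefix p q -> walk x q -> walk x p.
Proof. by case/prefixP=> p' ->; rewrite walk_cat => /andP[]. Qed.

Lemma walk_extend n (x : vertex G) :
  no_sinks G -> exists2 p, walk x p & size p = n.
Proof.
move=> nosink; elim: n x => [|n IHn] x; first by exists [::].
have [e oe] := nosink x; have [p wp sp] := IHn (ter e).
by exists (e :: p); rewrite /= ?sp // wp oe eqxx.
Qed.

End Walks.

(** * Truncated cones and their stabilization *)

Section FiniteGraph.
Variables (V E : finType) (o t : E -> V).
Local Open Scope mset_scope.

Definition out (v : V) : seq E := enum [pred e | o e == v].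
Definition succ (v : V) : seq V := [seq t e | e <- out v].

Lemma mem_out e v : (e \in out v) = (o e == v).
Proof. by rewrite mem_enum. Qed.

Lemma out_uniq v : uniq (out v).
Proof. exact: enum_uniq. Qed.

Lemma label_terminiE (X : choiceType) (l : V -> X) v :
  label_termini o t l v = seq_mset (map l (succ v)).
Proof. by rewrite /succ -map_comp. Qed.

(* The unfolding below a vertex, truncated at depth n, as a hereditary
   multiset. *)
Fixpoint cone_type (n : nat) : choiceType :=
  if n is n'.+1 then ({mset cone_type n'} : choiceType) else (unit : choiceType).

Fixpoint cone (n : nat) : V -> cone_type n :=
  if n is n'.+1 then (fun v => label_termini o t (@cone n') v) else (fun=> tt).

Lemma eq_coneS n v w :
  cone n.+1 v = cone n.+1 w <->
  perm_eq (map (cone n) (succ v)) (map (cone n) (succ w)).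
Proof. by rewrite /= !label_terminiE; split=> /eq_seq_msetP. Qed.

Lemma perm_map_coarsen (T : eqType) (X Y : eqType) (f : T -> X) (h : T -> Y) s s' :
  (forall a b, f a = f b -> h a = h b) ->
  perm_eq (map f s) (map f s') -> perm_eq (map h s) (map h s').
Proof.
move=> fh; elim: s s' => [|a s IHs] s'.
  by move/perm_size; rewrite /= size_map; case: s'.
move=> pss'; have : f a \in map f s' by rewrite -(perm_mem pss') mem_head.
case/mapP=> b bs' fab; have ps' := perm_to_rem bs'.
rewrite (permPr (perm_map h ps')) /= (fh _ _ fab) perm_cons; apply: IHs.
by move: pss'; rewrite (permPr (perm_map f ps')) /= fab perm_cons.
Qed.

Lemma cone_mono n v w : cone n.+1 v = cone n.+1 w -> cone n v = cone n w.
Proof.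
elim: n v w => [//|n IHn] v w /eq_coneS vw; apply/eq_coneS.
exact: perm_map_coarsen vw.
Qed.

(** By [cone_mono] the relations [S n] decrease. If every inclusion were strict, [#|S n| + n] would
    stay bounded, which is absurd. *)
Lemma cone_stable : exists n, forall v w,
  cone n v = cone n w -> cone n.+1 v = cone n.+1 w.
Proof.
pose S n : {set V * V} := [set x | cone n x.1 == cone n x.2]%SET.
have SS n : S n.+1 \subset S n.
  by apply/fintype.subsetP=> -[v w]; rewrite !inE /= => /eqP/cone_mono/eqP.
have [[n /eqP Sn]|noS] := pselect (exists n, S n.+1 == S n).
  exists n => v w /eqP vw; apply/eqP.
  have : (v, w) \in S n.+1 by rewrite Sn inE.
  by rewrite inE.
have small n : #|S n| + n <= #|{: V * V}|.
  elim: n => [|n IHn]; first by rewrite addn0 max_card.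
  apply: leq_trans IHn; rewrite addnS ltn_add2r proper_card //.
  rewrite finset.properEneq SS andbT; apply/negP=> Sn; apply: noS; by exists n.
by have := small #|{: V * V}|.+1; rewrite addnS ltnNge leq_addl.
Qed.

End FiniteGraph.

(** * Non-redundancy and separation of vertices by cones *)

Lemma nec_relation_of_unique_lift (H : digraph) (rV : rel (vertex H))
    (rE : rel (edge H)) :
  equivalence_rel rV -> equivalence_rel rE ->
  (forall e f, rE e f -> rV (org e) (org f) /\ rV (ter e) (ter f)) ->
  (forall e w, rV (org e) w -> exists! f, org f = w /\ rE e f) ->
  nec_relation rV rE.
Proof.
move=> eqV eqE compat lift; split=> //.
have [rVr rVs] : reflexive rV /\ symmetric rV.
  by have /equivalence_relP[r lt] := eqV; split=> // x y; apply/idP/idP=> /lt <-.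
have [rEr [rEs rEt]] : reflexive rE /\ symmetric rE /\ transitive rE.
  have /equivalence_relP[r lt] := eqE; split=> //.
  have s : symmetric rE by move=> x y; apply/idP/idP=> /lt <-.
  by split=> // y x z /lt ->.
(* The required bijections send [e] to its unique lift at [w]; the value for unrelated [w] is
   junk. *)
have /choice[pi piP] : forall we : vertex H * edge H, exists f : edge H,
    rV (org we.2) we.1 -> org f = we.1 /\ rE we.2 f.
  case=> w e /=; have [/lift[f [fP _]]|nr] := boolP (rV (org e) w).
    by exists f.
  by exists e.
exists (fun _ w e => pi (w, e)); split=> [v w vw|e f]; last first.
  split=> [ef|[oef <-]]; last by have [] := piP (org f, e) oef.
  have [oef _] := compat _ _ ef; split=> //.
  have [g [_ gP]] := lift _ _ oef.
  by rewrite -(gP _ (piP (org f, e) oef)) -(gP f).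
split=> [e /= oe | e f| f /= of_].
- by have [] := piP (w, e) ltac:(by rewrite /= oe).
- rewrite !in_setE => oe of_ pief.
  have [oe1 re] := piP (w, e) ltac:(by rewrite /= oe).
  have [of1 rf] := piP (w, f) ltac:(by rewrite /= of_).
  have ef : rE e f by apply: rEt re _; rewrite pief rEs.
  have [g [_ gP]] := lift e v ltac:(by rewrite oe).
  by rewrite -(gP e) // -(gP f).
- have [e [[oe fe] _]] := lift f v ltac:(by rewrite of_ rVs).
  exists e => //=; have vw' : rV (org e) w by rewrite oe.
  have [g [_ gP]] := lift e w vw'.
  by rewrite -(gP _ (piP (w, e) vw')) -(gP f) // rEs.
Qed.

Section NonRedundant.
Variables (V E : finType) (o t : E -> V) (R : V).
Let G := @Digraph V E o t.

(** At a depth where cones have stabilized, having equal cones is the vertex part of an n.e.c.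
    relation on the graph without [R], hence is equality there. *)
Lemma cone_separates : (forall e, t e != R) -> non_redundant (@delete G R) ->
  exists n, forall v w, v != R -> w != R ->
    cone o t n v = cone o t n w -> v = w.
Proof.
move=> tR nonred; have [n stable] := cone_stable o t; exists n.
pose c := cone o t n.
pose twins e := [seq f <- out o (o e) | c (t f) == c (t e)].
(* Edges are identified when their origins and termini have equal cones and they
   have the same rank among the edges with such termini leaving their origin. *)
pose key e := (c (o e), c (t e), index e (twins e)).
pose rV : rel (vertex (@delete G R)) := fun v w => c (val v) == c (val w).
pose rE : rel (edge (@delete G R)) := fun e f => key (val e) == key (val f).
have eqrel (T : Type) (K : eqType) (k : T -> K) :
    equivalence_rel (fun x y => k x == k y).
  by move=> x y z; split=> // /eqP ->.
have twins_in e : e \in twins e by rewrite mem_filter eqxx mem_out eqxx.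
suff /nonred[sep _] : nec_relation rV rE.
  move=> v w vR wR vw; suff /(congr1 val) : Sub v vR = Sub w wR :> {v | v != R} by [].
  by apply/sep/eqP.
apply: nec_relation_of_unique_lift; [exact: eqrel | exact: eqrel | |].
  by move=> e f /eqP[oef tef _]; split; apply/eqP.
move=> e w ew.
pose s := [seq f <- out o (val w) | c (t f) == c (t (val e))].
(* By stability the cones of [org e] and [w] agree one level deeper, so equally many edges lead from
   either to a given cone. *)
have ss : size (twins (val e)) = size s.
  move/eqP/stable/eq_coneS: ew => /seq.permP/(_ (pred1 (c (t (val e))))).
  by rewrite !count_map !size_filter.
have is_ : index (val e) (twins (val e)) < size s by rewrite -ss index_mem.
pose f := nth (val e) s (index (val e) (twins (val e))).
have : f \in s by rewrite mem_nth.
rewrite mem_filter mem_out => /andP[/eqP tf /eqP of_].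
have fR : (o f != R) && (t f != R) by rewrite of_ tR (valP w).
have key_of g : o g = val w -> c (t g) = c (t (val e)) -> twins g = s.
  by move=> og tg; rewrite /twins og tg.
exists (Sub f fR); split.
  split; first exact: val_inj.
  apply/eqP; rewrite /key [val (Sub _ _)]SubK of_ tf (key_of f) // /f.
  by rewrite (eqP ew) index_uniq // filter_uniq ?out_uniq.
move=> g [og /eqP[_ tg ig]]; apply: val_inj; rewrite SubK /f ig.
have og' : o (val g) = val w by rewrite -og.
by rewrite -(key_of (val g)) // nth_index.
Qed.

Lemma succ_inj : (forall e, t e != R) -> non_redundant (@delete G R) ->
  forall v w, v != R -> w != R -> perm_eq (succ o t v) (succ o t w) -> v = w.
Proof.
move=> tR /(cone_separates tR)[n sep] v w vR wR vw; apply: sep => //.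
by apply: cone_mono; apply/eq_coneS; apply: perm_map.
Qed.

End NonRedundant.

(** * From back types to an actual labelling *)

Section Labelling.
Variables (V E : finType) (o t : E -> V) (R : V).
Local Notation succ := (succ o t).

Lemma actual_labelling_of_back_types (b : V -> V) :
  (forall v w, v != R -> w != R -> perm_eq (succ v) (succ w) -> v = w) ->
  (forall e, t e != R) ->
  (forall v, v != R -> b v != R) ->
  (forall e, perm_eq (t e :: succ (b (t e)))
     (succ (o e) ++ (if o e == R then [::] else [:: b (o e)]))) ->
  has_actual_labelling o t R.
Proof.
move=> inj tR bR bE.
pose star v := succ v ++ (if v == R then [::] else [:: b v]).
(* A canonical vertex stands for all vertices with star [s] up to order, so vertices serve as
   labels; [R] is the default if there is none. *)
pose lab s := odflt R [pick w | perm_eq (star w) s].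
have labP s s' : perm_eq s s' -> lab s = lab s'.
  move=> ss'; congr odflt; apply: eq_pick => w; exact: permPr.
have star_lab v : perm_eq (star (lab (star v))) (star v).
  by rewrite /lab; case: pickP => //= /(_ v); rewrite perm_refl.
pose l v := lab (star v).
(* nb m a is the label of the neighbour reached through a branch of type a from
   a vertex surrounded by the branches m. *)
pose nb m a :=
  lab (odflt R [pick w | (w != R) && perm_eq (a :: succ w) m] :: succ a).
pose M x := seq_mset (map (nb (star x)) (star x)).
have nbP m m' : perm_eq m m' -> nb m =1 nb m'.
  move=> mm' a; rewrite /nb; congr (lab (odflt _ _ :: _)).
  by apply: eq_pick => w; rewrite (permPr mm').
have ME v : M (l v) = seq_mset (map (nb (star v)) (star v)).
  apply/eq_seq_msetP; rewrite (eq_map (nbP _ _ (star_lab v))).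
  exact/perm_map/star_lab.
(* By [inj], the vertex picked inside [nb] has only one candidate. *)
have nbE m a w : w != R -> perm_eq (a :: succ w) m -> nb m a = lab (w :: succ a).
  move=> wR aw; rewrite /nb; case: pickP => [w' /andP[w'R aw']|/(_ w)] /=.
    congr (lab (_ :: _)); apply: inj => //.
    by move: aw'; rewrite -(permPr aw) perm_cons.
  by rewrite wR aw.
have nb_succ v : map (nb (star v)) (succ v) = map l (succ v).
  apply/eq_in_map => a /mapP[e]; rewrite mem_out => /eqP <- {a}->.
  rewrite (@nbE _ _ (b (t e))) ?bR //.
  by apply: labP; rewrite /star (negPf (tR e)) perm_sym perm_catC.
(* By the hypothesis [bE], [v :: succ (b v)] is the star of the origin of every edge into [v], up to
   order. *)
exists V, l, (fun v => lab (val v :: succ (b (val v)))), M; split; last first.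
  rewrite label_terminiE ME -nb_succ.
  by have -> : star R = succ R by rewrite /star eqxx cats0.
case=> v vR /=.
have nb_star : map (nb (star v)) (star v) =
    map l (succ v) ++ [:: lab (v :: succ (b v))].
  rewrite {2}/star (negPf vR) map_cat nb_succ /= (@nbE _ _ v) //.
  by rewrite /star (negPf vR) perm_sym perm_catC.
split; last by move=> e te; rewrite -te; apply: labP; rewrite perm_sym bE.
- by rewrite ME nb_star in_mset mset_seqE count_cat /= eqxx addnCA.
- rewrite label_terminiE ME nb_star; apply/msetP => x.
  by rewrite msetB1E !mset_seqE count_cat /= addn0 eq_sym addnK.
Qed.

End Labelling.

(** * Branches seen looking back depend only on the last vertex *)

Section BackTypes.
Variables (V E : finType) (o t : E -> V) (R : V).
Let G := @Digraph V E o t.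
Local Notation succ := (succ o t).
Local Notation wk := (@walk G).
Local Notation tm := (@terminus G).

(* a (rcons p e) is the vertex whose cone is the branch of the unfolding seen
   from rcons p e across its last edge. *)
Definition back_labels (a : seq E -> V) (q : seq E) : Prop :=
  forall p e, prefix (rcons p e) q ->
    a (rcons p e) != R /\
    perm_eq (t e :: succ (a (rcons p e)))
            (succ (tm R p) ++ (if nilp p then [::] else [:: a p])).

Hypotheses (tR : forall e, t e != R) (nonred : non_redundant (@delete G R)).

Lemma terminus_neq_root p : p != [::] -> tm R p != R.
Proof. by case/lastP: p => // p e _; rewrite terminus_rcons tR. Qed.

(** The conditions determine [succ (a (rcons p e))] from [a p], and [succ_inj] recovers the vertex.
    For empty [p] no earlier value of [a] enters. *)
Lemma back_labels_unique a a' q q' p : back_labels a q -> back_labels a' q' ->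
  p != [::] -> prefix p q -> prefix p q' -> a p = a' p.
Proof.
move=> aq aq'; elim/last_ind: p => // p e IHp _ pq pq'.
have [aR ap] := aq _ _ pq; have [aR' ap'] := aq' _ _ pq'.
apply: (succ_inj tR nonred) => //; rewrite -(perm_cons (t e)) (permPl ap) perm_sym.
rewrite (permPl ap'); case: p IHp pq pq' {ap ap' aR aR'} => // f p IHp pq pq'.
by rewrite IHp //; apply: prefix_trans (prefix_rcons _ _) _; eassumption.
Qed.

Lemma back_labels_uniform :
  (forall q, wk R q -> exists a, back_labels a q) ->
  exists a, forall q, wk R q -> back_labels a q.
Proof.
move=> exa; have /choice[A AP] : forall q, exists a, wk R q -> back_labels a q.
  by move=> q; have [/exa[a]|] := boolP (wk R q); [exists a | exists (fun=> R)].
(* Diagonal choice: by uniqueness, the labels chosen for [p] and for [rcons p e] agree at [p]. *)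
exists (fun p => A p p) => q wq p e pq.
have wp : wk R (rcons p e).
  by case/prefixP: pq wq => q' ->; rewrite walk_cat => /andP[].
have [AR Ap] := AP _ wp _ _ (prefix_refl _); split=> //.
case: p pq wp {AR} Ap => // f p pq wp Ap.
have wp' : wk R (f :: p).
  by move: wp; rewrite -cats1 walk_cat => /andP[].
rewrite (back_labels_unique (AP _ wp') (AP _ wp)) ?prefix_refl //.
exact: prefix_rcons.
Qed.

(* Extending p and p' by the same long path makes the branches seen when
   looking back agree to large depth, hence equal by non-redundancy; by
   injectivity of succ this descends to p and p'. *)
Lemma back_labels_terminus a : no_sinks G ->
  (forall q, wk R q -> back_labels a q) ->
  forall p p', p != [::] -> p' != [::] -> wk R p -> wk R p' ->
  tm R p = tm R p' -> a p = a p'.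
Proof.
move=> nosink aP p p' p0 p'0 wp wp' pp'.
have [n sep] := cone_separates tR nonred.
have [w ww sw] := walk_extend n (tm R p) nosink.
have ww' : wk (tm R p') w by rewrite -pp'.
have cat0 q u : q != [::] -> nilp (q ++ u) = false.
  by case: q.
have step q u e : q != [::] -> wk R q -> wk (tm R q) (rcons u e) ->
    a (q ++ rcons u e) != R /\
    perm_eq (t e :: succ (a (q ++ rcons u e)))
      (succ (tm R (q ++ u)) ++ [:: a (q ++ u)]).
  move=> q0 wq wu; have := aP (q ++ rcons u e) ltac:(by rewrite walk_cat wq).
  by rewrite -rcons_cat => /(_ _ _ (prefix_refl _)); rewrite cat0.
have step2 u e : wk (tm R p) (rcons u e) ->
    [/\ a (p ++ rcons u e) != R, a (p' ++ rcons u e) != R &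
    exists m, perm_eq (t e :: succ (a (p ++ rcons u e))) (m ++ [:: a (p ++ u)]) /\
      perm_eq (t e :: succ (a (p' ++ rcons u e))) (m ++ [:: a (p' ++ u)])].
  move=> wu; have [aR ap] := step _ _ _ p0 wp wu.
  have [|aR' ap'] := step p' u e p'0 wp'; first by rewrite -pp'.
  split=> //; exists (succ (tm R (p ++ u))); split=> //.
  by rewrite terminus_cat pp' -terminus_cat.
(* Each common edge gains one level: the back branches after [rcons u e] share the part [m] and
   differ at most in the back branch after [u]. *)
have deep u : wk (tm R p) u -> u != [::] ->
    cone o t (size u) (a (p ++ u)) = cone o t (size u) (a (p' ++ u)).
  elim/last_ind: u => [//|u e IHu] wu _; have [_ _ [m [ap ap']]] := step2 _ _ wu.
  rewrite size_rcons; apply/eq_coneS.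
  rewrite -(perm_cons (cone o t (size u) (t e))) -!map_cons.
  rewrite (permPl (perm_map _ ap)) (permPr (perm_map _ ap')) !map_cat perm_cat2l /=.
  case: u IHu wu {m ap ap'} => // f u IHu; rewrite -cats1 walk_cat.
  by case/andP=> wu _; rewrite IHu.
have aR q : q != [::] -> wk R q -> a q != R.
  case/lastP: q => // q e _ wq.
  by have [] := aP _ wq _ _ (prefix_refl _).
have cp0 q u : q != [::] -> q ++ u != [::] by case: q.
have aw : a (p ++ w) = a (p' ++ w).
  apply: sep; rewrite ?aR ?cp0 // ?walk_cat ?wp ?wp' //.
  rewrite -sw; case: {sw ww'} w ww => [|e u] wu; last exact: deep.
  by [].
(* Equal labels after [rcons u e] give equal multisets; cancelling [m] gives equal labels after
   [u]. *)
elim/last_ind: w {sw ww'} ww aw => [|u e IHu]; first by rewrite !cats0.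
move=> wu aue; apply: IHu; first by move: wu; rewrite -cats1 walk_cat => /andP[].
have [_ _ [m [ap]]] := step2 _ _ wu.
rewrite -aue (permPl ap) perm_cat2l => /perm_mem/(_ (a (p ++ u))).
by rewrite !inE eqxx => /esym/eqP.
Qed.

(** By [back_labels_terminus] any path to [v] may define [b v]. So the chosen path to [t e] can be
    traded for the one to [o e] followed by [e]. *)
Lemma back_types : @rooted G R -> no_sinks G ->
  (forall q, wk R q -> exists a, back_labels a q) ->
  exists b : V -> V, (forall v, v != R -> b v != R) /\
  forall e, perm_eq (t e :: succ (b (t e)))
     (succ (o e) ++ (if o e == R then [::] else [:: b (o e)])).
Proof.
move=> root nosink /back_labels_uniform[a aP].
have /choice[P PP] : forall v, exists p, wk R p /\ tm R p = v by exact: root.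
have P0 v : v != R -> P v != [::].
  by apply: contra => /eqP Pv; have [_] := PP v; rewrite Pv => <-.
have aR p e : wk R (rcons p e) -> _ := fun wp => aP _ wp p e (prefix_refl _).
exists (fun v => a (P v)); split=> [v vR|e].
  have := P0 v vR; have [+ _] := PP v.
  by case/lastP: (P v) => // p e /aR[].
have [wte tte] := PP (t e); have [woe toe] := PP (o e).
have aE p : wk R (rcons p e) -> a (P (t e)) = a (rcons p e).
  move=> wp; apply: back_labels_terminus => //; first exact: P0.
    by case: p {wp}.
  by rewrite tte terminus_rcons.
have [oR|oR] := eqVneq (o e) R.
  have we : wk R (rcons [::] e) by rewrite /= oR eqxx.
  by rewrite (aE _ we); have [_] := aR _ _ we; rewrite oR.
have we : wk R (rcons (P (o e)) e).
  by rewrite walk_rcons woe; apply/eqP.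
rewrite (aE _ we); have [_] := aR _ _ we.
by rewrite toe; case: (P (o e)) (P0 _ oR).
Qed.

End BackTypes.

Lemma inverse_morphism (G H : digraph) (fV : vertex G -> vertex H)
    (fE : edge G -> edge H) gV gE :
  cancel fV gV -> cancel gV fV -> cancel fE gE -> cancel gE fE ->
  (forall e, org (fE e) = fV (org e)) -> (forall e, ter (fE e) = fV (ter e)) ->
  (forall e, org (gE e) = gV (org e)) /\ (forall e, ter (gE e) = gV (ter e)).
Proof.
by move=> fK gK fEK gEK fo ft; split=> e; apply: (can_inj fK); rewrite gK -?fo -?ft gEK.
Qed.

(** * Rerooted unfolding trees *)

Section Tree.
Variables (G : digraph) (R : vertex G).
Local Notation T := (unfolding R).
Local Notation root := (unfold_root R).

(** Adjacency with orientation forgotten, as isomorphisms of rerooted trees need not respect the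
    original orientation. *)
Definition adjacent (x y : seq (edge G)) : Prop :=
  exists e, y = rcons x e \/ x = rcons y e.

Lemma adjacent_sym x y : adjacent x y -> adjacent y x.
Proof. by case=> e [] ->; exists e; [right|left]. Qed.

Lemma tree_edge (y : vertex T) x e : val y = rcons x e ->
  exists f : edge T, val (org f) = x /\ ter f = y.
Proof.
case: y => y wy /= yE; have := wy; rewrite {1}yE walk_rcons => /andP[wx ex].
exists (exist _ (exist _ x wx, e) ex); split=> //.
exact: val_inj.
Qed.

Lemma val_terminus_tree (x : vertex T) w : walk x w ->
  val (terminus x w) = val x ++ [seq (val f).2 | f <- w].
Proof.
elim/last_ind: w => [|w f IHw]; first by rewrite cats0.
rewrite walk_rcons => /andP[/IHw wE /eqP of_].
by rewrite terminus_rcons map_rcons -rcons_cat -wE -of_.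
Qed.

Lemma walk_tree (x y : vertex T) : prefix (val x) (val y) ->
  exists w, walk x w /\ terminus x w = y.
Proof.
case/prefixP=> z; elim/last_ind: z y => [|z e IHz] y yE.
  by exists [::]; split=> //; apply: val_inj; rewrite yE cats0.
have [f [of_ tf]] := @tree_edge y (val x ++ z) e ltac:(by rewrite yE rcons_cat).
have [w [ww tw]] := IHz (org f) of_; exists (rcons w f).
by rewrite walk_rcons ww tw eqxx terminus_rcons.
Qed.

Lemma on_root_pathE (q : vertex T) (f : edge T) :
  on_root_path root q f <-> prefix (val (ter f)) (val q).
Proof.
split=> [[w [ww <- fw]]|].
  case/path.splitPr: fw ww => w1 w2 ww.
  rewrite -cat_rcons in ww *; have ww1 := walk_prefix (prefix_prefix _ _) ww.
  rewrite (val_terminus_tree ww) map_cat catA -(val_terminus_tree ww1).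
  by rewrite terminus_rcons prefix_prefix.
case/walk_tree=> w [ww tw].
have [w0 [ww0 tw0]] : exists w0, walk root w0 /\ terminus root w0 = org f.
  by apply: walk_tree; exact: prefix0s.
have wf : walk root (rcons w0 f) by rewrite walk_rcons ww0 tw0 eqxx.
exists (rcons w0 f ++ w).
have -> : walk root (rcons w0 f ++ w) by rewrite walk_cat wf terminus_rcons.
split=> //; last by rewrite mem_cat mem_rcons mem_head.
by rewrite terminus_cat terminus_rcons.
Qed.

Lemma reroot_adjacent u (f : edge (reroot root u)) :
  adjacent (val (org f)) (val (ter f)).
Proof.
exists (val f).2; rewrite /=; case: asboolP => _; by [right|left].
Qed.

Lemma reroot_edge u (x y : vertex T) : adjacent (val x) (val y) ->
  exists f : edge (reroot root u),
    (org f = x /\ ter f = y) \/ (org f = y /\ ter f = x).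
Proof.
case=> e [/tree_edge[f [/val_inj of_ tf]]|/tree_edge[f [/val_inj of_ tf]]];
  by rewrite -of_ -tf; exists f => /=; case: asboolP => _; auto.
Qed.

(** After rerooting, all edges point away from [q]. This characterizes [q] in a way that
    isomorphisms preserve. *)
Lemma reroot_root (q x : vertex T) :
  (forall f : edge (reroot root q), ter f <> x) <-> x = q.
Proof.
split=> [nox|-> f /=].
  apply/eqP/negPn/negP=> /eqP xq.
  have [xpq|nxq] := boolP (prefix (val x) (val q)).
    case/prefixP: (xpq) => -[|e z] qE.
      by apply: xq; apply: val_inj; rewrite qE cats0.
    have pq : prefix (rcons (val x) e) (val q).
      by rewrite qE -cat_rcons prefix_prefix.
    have wy := walk_prefix pq (valP q).
    have [f [of_ tf]] := @tree_edge (Sub (rcons (val x) e) wy : vertex T) _ e erefl.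
    apply: (nox f) => /=; rewrite asboolT; first exact: val_inj.
    by apply/on_root_pathE; rewrite tf.
  move xE: (val x) => s; case/lastP: s xE => [xE|z e xE].
    by rewrite xE prefix0s in nxq.
  have [f [of_ tf]] := tree_edge xE.
  apply: (nox f) => /=; rewrite asboolF //.
  by move/on_root_pathE; rewrite tf; apply/negP.
case: asboolP => [/on_root_pathE pq oq|nf tf].
  by move: pq; rewrite -oq => /size_prefix; rewrite size_rcons ltnn.
by apply: nf; apply/on_root_pathE; rewrite -tf prefix_refl.
Qed.

Lemma reroot_isomorphism (u s : vertex T) :
  isomorphic (reroot root u) (reroot root s) ->
  exists (g h : vertex T -> vertex T),
  [/\ cancel g h, cancel h g, g u = s,
      (forall x y, adjacent (val x) (val y) -> adjacent (val (g x)) (val (g y))) &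
      (forall x y, adjacent (val x) (val y) -> adjacent (val (h x)) (val (h y)))].
Proof.
case=> g [gE [[h gK hK] [hE gEK hEK] go gt]].
have [ho ht] := inverse_morphism gK hK gEK hEK go gt.
exists g, h; split=> //.
- apply/(@reroot_root s) => f ff; have /reroot_root/(_ (hE f)) := erefl u.
  by apply; rewrite ht ff gK.
- move=> x y /(@reroot_edge u)[f [] [<- <-]]; have := reroot_adjacent (gE f);
    by rewrite go gt // => /adjacent_sym.
- move=> x y /(@reroot_edge s)[f [] [<- <-]]; have := reroot_adjacent (hE f);
    by rewrite ho ht // => /adjacent_sym.
Qed.

End Tree.

(** * The orbit of the root under undirected automorphisms *)

Section Orbit.
Variables (G : digraph) (R : vertex G).
Local Notation root := (unfold_root R).
Local Notation wk := (walk R).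

Definition parent (x : seq (edge G)) := take (size x).-1 x.

Lemma parent_rcons x e : parent (rcons x e) = x.
Proof. by rewrite /parent size_rcons /= -cats1 take_size_cat. Qed.

(* g acts on the paths from R; its values on other edge sequences are junk. *)
Definition tree_hom (g h : seq (edge G) -> seq (edge G)) : Prop :=
  forall x, wk x -> [/\ wk (g x), h (g x) = x &
    forall y, wk y -> adjacent x y -> adjacent (g x) (g y)].

Lemma tree_hom_of_vertex_map (g h : vertex (unfolding R) -> vertex (unfolding R)) :
  cancel g h ->
  (forall x y, adjacent (val x) (val y) -> adjacent (val (g x)) (val (g y))) ->
  let ext (f : vertex (unfolding R) -> vertex (unfolding R)) x :=
    if insub x is Some x' then val (f x') else x in
  tree_hom (ext g) (ext h).
Proof.
move=> gK gadj /= x wx; rewrite insubT /=; split.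
- exact: valP.
- by rewrite valK gK.
- by move=> y wy xy; rewrite insubT; apply: gadj.
Qed.

(** Going from [u] up to the root takes [size u] steps. The image moves one step at a time and
    starts too deep below [q] to leave that branch. *)
Lemma prefix_image_root g h q u : tree_hom g h -> wk u -> prefix q (g u) ->
  size q + size u <= size (g u) -> prefix q (g [::]).
Proof.
move=> gh; elim/last_ind: u => [//|u e IHu] wue qgue.
have wu := walk_prefix (prefix_rcons u e) wue.
have [_ _ /(_ _ wue)[|f guf]] := gh _ wu; first by exists e; left.
rewrite size_rcons addnS => sgue; have {}IHu := IHu wu.
case: guf => guf; last first.
  apply: IHu; rewrite guf.
    exact: prefix_trans qgue (prefix_rcons _ _).
  by rewrite size_rcons ltnW // ltnW.
move: qgue sgue; rewrite guf size_rcons => qgu sgu; apply: IHu => //.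
by move: qgu; rewrite !prefixE -cats1 takel_cat // (leq_trans (leq_addr _ _) sgu).
Qed.

Lemma root_orbit_cofinal : no_sinks G -> cocompact root ->
  forall q, wk q -> exists g h, [/\ tree_hom g h, tree_hom h g & prefix q (g [::])].
Proof.
move=> nosink [F [l lP]] q wq.
have /choice[rep repP] : forall c, exists u, (exists s, l s = c) -> l u = c.
  move=> c; have [[s ls]|] := pselect (exists s, l s = c); first by exists s.
  by exists root.
(* [n] bounds the depth of all representatives, so extending [q] by [n] edges gives a vertex deep
   enough for [prefix_image_root]. *)
pose n := \max_c size (val (rep c)).
have [w ww sw] := walk_extend n (terminus R q) nosink.
have wqw : wk (q ++ w) by rewrite walk_cat wq.
pose s : vertex (unfolding R) := Sub (q ++ w) wqw.
have lu : l (rep (l s)) = l s by apply: repP; exists s.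
have [g [h [gK hK gu gadj hadj]]] := reroot_isomorphism (lP _ _ lu).
have gh := tree_hom_of_vertex_map gK gadj.
exists (fun x => if insub x is Some x' then val (g x') else x).
exists (fun x => if insub x is Some x' then val (h x') else x).
split=> //; first exact: tree_hom_of_vertex_map hK hadj.
apply: (prefix_image_root gh (valP (rep (l s)))); rewrite valK gu SubK.
  exact: prefix_prefix.
rewrite size_cat leq_add2l sw.
exact: (@leq_bigmax _ (fun c => size (val (rep c)))).
Qed.

(* The neighbour of x on the way to q (q itself if x = q). *)
Definition toward (q x : seq (edge G)) : seq (edge G) :=
  if prefix x q then take (size x).+1 q else parent x.

Lemma toward_adjacent q x y :
  adjacent x y -> toward q x = y \/ toward q y = x.
Proof.
have key z e : toward q z = rcons z e \/ toward q (rcons z e) = z.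
  rewrite /toward; have [/prefixP[z' ->]|_] := boolP (prefix (rcons z e) q).
    left; rewrite cat_rcons prefix_prefix take_cat ltnNge leqnSn /= subSnn /=.
    by rewrite take0 cats1.
  by right; apply: parent_rcons.
by case=> e [] ->; [|apply/or_comm]; apply: key.
Qed.

(** Induction from the root: the step from [g x] towards [g [::]] already leads to the image of the
    parent of [x], or stays put if [x] is empty. By injectivity it is not [g (rcons x e)]. *)
Lemma image_parent g h x : tree_hom g h -> wk x -> x != [::] ->
  g (parent x) = toward (g [::]) (g x).
Proof.
move=> gh; elim/last_ind: x => // x e IHx wxe _; rewrite parent_rcons.
have wx := walk_prefix (prefix_rcons x e) wxe.
have [_ _ /(_ _ wxe)[|f adj_f]] := gh _ wx; first by exists e; left.
have [] // : toward (g [::]) (g x) = g (rcons x e) \/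
    toward (g [::]) (g (rcons x e)) = g x.
  by apply: toward_adjacent; exists f.
have [x0|x0] := eqVneq x [::].
  rewrite x0 in wxe *; rewrite /toward prefix_refl take_oversize // => g0.
  have : h (g [::]) = h (g (rcons [::] e)) by rewrite g0.
  have [_ -> _] := gh [::] isT.
  by have [_ -> _] := gh _ wxe.
rewrite -IHx // => gpx.
have wp : wk (parent x) by apply: walk_prefix wx; rewrite /parent prefix_take.
have : h (g (parent x)) = h (g (rcons x e)) by rewrite gpx.
have [_ -> _] := gh _ wp; have [_ -> _] := gh _ wxe.
move/(congr1 size); rewrite size_rcons => sx.
by have := prefix_take x (size x).-1 => /size_prefix; rewrite [size _]sx ltnn.
Qed.

End Orbit.

(** * Back labels read off from an automorphism *)

Section Neighbours.
Variables (V E : finType) (o t : E -> V) (R : V).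
Let G := @Digraph V E o t.
Local Notation succ := (succ o t).
Local Notation out := (out o).
Local Notation wk := (@walk G R).
Local Notation tm := (@terminus G R).

Definition children (x : seq E) : seq (seq E) :=
  [seq rcons x e | e <- out (tm x)].

Definition neighbours (x : seq E) : seq (seq E) :=
  (if nilp x then [::] else [:: @parent G x]) ++ children x.

Lemma tm_children x : [seq tm y | y <- children x] = succ (tm x).
Proof. by rewrite -map_comp; apply: eq_map => e /=; rewrite terminus_rcons. Qed.

Lemma mem_neighbours x y : wk x ->
  (y \in neighbours x) <-> wk y /\ @adjacent G x y.
Proof.
move=> wx; rewrite mem_cat; split.
  case/orP=> [|/mapP[e]].
    case/lastP: x wx => // x e wxe.
    have -> : nilp (rcons x e) = false by rewrite /nilp size_rcons.
    rewrite parent_rcons inE => /eqP ->; split; last by exists e; right.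
    exact: walk_prefix (prefix_rcons x e) wxe.
  rewrite mem_out => /eqP oe ->; split; last by exists e; left.
  by rewrite walk_rcons wx; apply/eqP.
case=> wy [e [yE|xE]]; apply/orP; [right|left].
  apply/mapP; exists e => //; rewrite mem_out.
  by move: wy; rewrite yE walk_rcons => /andP[].
have -> : nilp x = false by rewrite xE /nilp size_rcons.
by rewrite xE parent_rcons mem_head.
Qed.

Lemma neighbours_uniq x : uniq (neighbours x).
Proof.
rewrite cat_uniq map_inj_uniq ?out_uniq ?andbT; last first.
  by move=> e f /rcons_inj[].
case/lastP: x => [|x e]; first by apply/hasPn=> y _; rewrite in_nil.
have -> : nilp (rcons x e) = false by rewrite /nilp size_rcons.
rewrite parent_rcons; apply/hasPn=> y /mapP[f _ ->]; rewrite inE.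
apply/negP=> /eqP/(congr1 size)/eqP.
by rewrite !size_rcons -addn2 -{2}[size x]addn0 eqn_add2l.
Qed.

Lemma perm_neighbours g h x : @tree_hom G R g h -> @tree_hom G R h g -> wk x ->
  perm_eq (map g (neighbours x)) (neighbours (g x)).
Proof.
move=> gh hg wx; have [wgx hgx gadj] := gh _ wx; apply: uniq_perm.
- rewrite map_inj_in_uniq ?neighbours_uniq // => y z.
  move=> /(mem_neighbours _ wx)[wy _] /(mem_neighbours _ wx)[wz _] gyz.
  by have [_ <- _] := gh _ wy; have [_ <- _] := gh _ wz; rewrite gyz.
- exact: neighbours_uniq.
move=> y; apply/mapP/idP => [[z /(mem_neighbours _ wx)[wz xz] ->]|].
  by apply/(mem_neighbours _ wgx); split; [have [] := gh _ wz | exact: gadj].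
case/(mem_neighbours _ wgx) => wy gxy; have [why ghy _] := hg _ wy.
exists (h y) => //.
apply/(mem_neighbours _ wx); split=> //.
by have [_ _ /(_ _ wy gxy)] := hg _ wgx; rewrite hgx.
Qed.

Section BackLabels.
Variables (g h : seq E -> seq E).
Hypotheses (gh : @tree_hom G R g h) (hg : @tree_hom G R h g).
Hypotheses (tR : forall e, t e != R) (nonred : non_redundant (@delete G R)).
Let q := g [::].
(** The vertex whose cone is the branch at [x] facing away from [q], since [h] carries [q] to the
    root. *)
Let tau x := tm (h x).

Let tau_neq_root x : wk x -> x != q -> tau x != R.
Proof.
move=> wx xq; apply: terminus_neq_root => //; apply: contra xq => /eqP hx.
by have [_ <- _] := hg wx; rewrite hx.
Qed.

(** [h] maps the neighbours of [x] to those of [h x]; the one towards [q] goes to the parent, the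
    others to the children. *)
Let tau_neighbours x : wk x -> x != q ->
  perm_eq (tau (@toward G q x) :: succ (tau x))
    ((if nilp x then [::] else [:: tau (@parent G x)]) ++ map tau (children x)).
Proof.
move=> wx xq; have [whx ghx _] := hg wx.
have hx0 : h x != [::] by apply: contra xq => /eqP hx; rewrite -ghx hx.
have := perm_map tm (perm_neighbours hg gh wx).
rewrite perm_sym /neighbours [nilp (h x)]nilpE (negPf hx0).
rewrite -map_comp map_cat map_cat tm_children /=.
have wp : wk (@parent G (h x)) by apply: walk_prefix whx; exact: prefix_take.
have <- : h (@toward G q x) = @parent G (h x).
  have := image_parent gh whx hx0; rewrite ghx -/q => <-.
  by have [_ ->] := gh wp.
by case: (nilp x).
Qed.

(* Off the path to q, h maps the branch below x to a branch below h x, so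
   tau x and tm x have isomorphic cones. *)
Let tau_off_path x : wk x -> ~~ prefix x q -> tau x = tm x.
Proof.
move=> wx xq; have [n sep] := cone_separates tR nonred.
have x0 : x != [::] by apply: contraNneq xq => ->; exact: prefix0s.
have xNq : x != q by apply: contraNneq xq => ->; exact: prefix_refl.
apply: sep; [exact: tau_neq_root | exact: terminus_neq_root |].
elim: n x wx xq x0 xNq => [//|n IHn] x wx xq x0 xNq; apply/eq_coneS.
have := tau_neighbours wx xNq; rewrite /toward (negPf xq) nilpE (negPf x0).
rewrite perm_cons => /(perm_map (cone o t n))/permPl ->; rewrite -tm_children -!map_comp.
suff /eq_in_map -> : {in out (tm x), cone o t n \o (tau \o rcons x)
    =1 cone o t n \o (tm \o rcons x)} by [].
move=> e; rewrite mem_out /= => /eqP oe.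
have wxe : wk (rcons x e) by rewrite walk_rcons wx; apply/eqP.
have xeq : ~~ prefix (rcons x e) q.
  by apply: contra xq; apply: prefix_trans; apply: prefix_rcons.
apply: IHn => //; first by case: (x).
by apply: contraNneq xeq => ->; exact: prefix_refl.
Qed.

(** Looking back from [rcons p e] on the way to [q], one sees the branch at [p] facing away from
    [q], which is the cone of [tau p]. *)
Lemma back_labels_of_automorphism :
  back_labels o t R (fun x => tau (@parent G x)) q.
Proof.
move=> p e peq; rewrite (@parent_rcons G).
have [wq _ _] := gh (isT : wk [::]).
have wpe : wk (rcons p e) := @walk_prefix G _ _ _ peq wq.
have wp := @walk_prefix G _ _ _ (prefix_rcons p e) wpe.
have pq : p != q.
  by apply: contraTneq peq => ->; apply/negP=> /size_prefix; rewrite size_rcons ltnn.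
split; first exact: tau_neq_root.
have twd : @toward G q p = rcons p e.
  rewrite /toward (prefix_trans (prefix_rcons p e) peq).
  by case/prefixP: peq => z ->; rewrite -(size_rcons p e) take_size_cat.
have oe : o e = tm p by move: wpe; rewrite walk_rcons => /andP[_ /eqP].
have eout : e \in out (tm p) by rewrite mem_out oe.
have pout := perm_to_rem eout.
(* Edges other than [e] leave the path to [q], so [tau_off_path] applies to them. *)
have tau_rem : [seq tau (rcons p f) | f <- rem e (out (tm p))] =
    [seq t f | f <- rem e (out (tm p))].
  apply/eq_in_map=> f; rewrite mem_rem_uniq ?out_uniq // => /andP[/= fe].
  rewrite mem_out => /eqP of_.
  rewrite tau_off_path ?terminus_rcons //; first by rewrite walk_rcons wp; apply/eqP.
  apply: contra fe => pfq; case/prefixP: peq => z qE.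
  move: pfq; rewrite qE prefixE take_cat !size_rcons ltnn subnn take0 cats0.
  by move=> /eqP/rcons_inj[->].
have := tau_neighbours wp pq; rewrite twd perm_sym perm_catC -map_comp.
rewrite (permPl (perm_cat (perm_map _ pout) (perm_refl _))) /= perm_cons tau_rem.
have psucc : perm_eq (succ (tm p)) (t e :: [seq t f | f <- rem e (out (tm p))]).
  exact: (perm_map t pout).
move=> tau_p; rewrite (permPr (perm_cat psucc (perm_refl _))) /= perm_cons.
by rewrite perm_sym.
Qed.

End BackLabels.
End Neighbours.

Theorem theorem1p1 (V E : finType) (o t : E -> V) (R : V)
    (G := @Digraph V E o t) :
  @rooted G R ->
  no_sinks G ->
  (forall e, t e != R) ->
  2 < #|[pred e | o e == R]| ->
  strongly_connected (@delete G R) ->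
  non_redundant (@delete G R) ->
  @cocompact (@unfolding G R) (@unfold_root G R) ->
  has_actual_labelling o t R.
Proof.
move=> root nosink tR _ _ nonred cocpt.
have labels q : @walk G R q -> exists a, back_labels o t R a q.
  move=> wq; have [g [h [gh hg qg]]] := root_orbit_cofinal nosink cocpt wq.
  eexists => p e pq; apply: (back_labels_of_automorphism gh hg tR nonred).
  exact: prefix_trans pq qg.
have [b [bR bE]] := back_types tR nonred root nosink labels.
exact: actual_labelling_of_back_types (succ_inj tR nonred) tR bR bE.
Qed.
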